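(* Let $\mathcal{Z}:=\{S\subseteq\omega: |S\cap[1,n]|/n\to 0 \text{ as } n\to\infty\}$. The space $c_0(\mathcal{Z})\cap\ell_\infty$ of bounded real sequences that are statistically convergent to $0$ is not isomorphic to $\ell_\infty$.
   Context: $\mathcal{Z}$ is the ideal of asymptotic density zero sets. A real sequence $(x_n)_{n\in\omega}$ is statistically convergent to $0$ (i.e. $\mathcal{Z}$-convergent to $0$) if $\{n: x_n\notin U\}\in\mathcal{Z}$ for every neighborhood $U$ of $0$; $c_0(\mathcal{Z})$ denotes the space of all such sequences. $\ell_\infty$ is the Banach space of bounded real sequences indexed by $\omega$ with the sup norm; $c_0(\mathcal{Z})\cap\ell_\infty$ is a closed linear subspace of it, equipped with the sup norm. Isomorphic means isomorphic as Banach spaces, i.e. there is a linear homeomorphism between the spaces (not necessarily an isometry). *)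

(* Defs.v *)
From HB Require Import structures.
From mathcomp Require Import all_boot all_order all_algebra.
From mathcomp Require Import finmap.
From mathcomp Require Import all_classical all_reals all_analysis.

Set Implicit Arguments.
Unset Strict Implicit.
Unset Printing Implicit Defensive.

Import Order.TTheory GRing.Theory Num.Theory.
Import numFieldNormedType.Exports.

Local Open Scope classical_set_scope.
Local Open Scope ring_scope.

Definition isomorphic (R : realType) (V W : normedModType R) : Prop :=
  exists (f : {linear V -> W}) (g : W -> V),
    [/\ cancel f g, cancel g f, continuous f & continuous g].

(* The quotient at n = 0 is 0 / 0 = 0; it does not affect the limit. *)
Definition density_ratio (R : realType) (S : set nat) (n : nat) : R :=
  #|` fset_set (S `&` [set k | (1 <= k <= n)%N])|%:R / n%:R.

Definition density_ideal (R : realType) : set (set nat) :=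
  [set S | @density_ratio R S @ \oo --> (0 : R)].

Definition c0 (R : realType) (I : set (set nat)) : set (nat -> R) :=
  [set x | forall U : set R, nbhs (0 : R) U -> I [set n | ~ U (x n)]].

Section Linf.
Variable R : realType.

Definition linf_pred : {pred (nat -> R)} :=
  fun x => `[< [bounded x n | n in [set: nat]] >].

Record linf : Type := Linf {
  linf_seq :> nat -> R ;
  linf_seqP : linf_seq \in linf_pred }.

HB.instance Definition _ := [isSub for linf_seq].
HB.instance Definition _ := [Choice of linf by <:].

Lemma linf_predP (x : nat -> R) :
  reflect (exists M, forall n, `|x n| <= M) (x \in linf_pred).
Proof.
apply: (iffP idP) => [/asboolP[M [_ xM]]|[M xM]].
  by exists (M + 1) => n; apply: xM => //; rewrite ltrDl.
apply/asboolP; exists M; split; first exact: num_real.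
by move=> N /ltW MN n _; exact: le_trans (xM n) MN.
Qed.

Fact linf_submod_closed : submod_closed linf_pred.
Proof.
split=> [|a x y /linf_predP[M xM] /linf_predP[N yN]].
  by apply/linf_predP; exists 0 => n; rewrite normr0.
apply/linf_predP; exists (`|a| * M + N) => n.
apply: le_trans (ler_normD _ _) _; apply: lerD => //.
by rewrite normrM ler_wpM2l.
Qed.

HB.instance Definition _ :=
  GRing.isSubmodClosed.Build R (nat -> R) linf_pred linf_submod_closed.
HB.instance Definition _ := [SubChoice_isSubLmodule of linf by <:].

Definition sup_norm (x : linf) : R := sup [set `|x n| | n in [set: nat]].

Lemma sup_norm_ub (x : linf) n : `|x n| <= sup_norm x.
Proof.
have /linf_predP[M xM] := linf_seqP x.
by apply: ub_le_sup; [exists M => _ [k _ <-] | exists n].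
Qed.

Lemma sup_norm_le (x : linf) M : (forall n, `|x n| <= M) -> sup_norm x <= M.
Proof.
move=> xM; apply: ge_sup; first by exists `|x 0%N|, 0%N.
by move=> _ [n _ <-].
Qed.

Fact sup_normD (x y : linf) : sup_norm (x + y) <= sup_norm x + sup_norm y.
Proof.
apply: sup_norm_le => n; apply: le_trans (ler_normD _ _) _.
by apply: lerD; exact: sup_norm_ub.
Qed.

Fact sup_normZ (a : R) (x : linf) : sup_norm (a *: x) = `|a| * sup_norm x.
Proof.
have le_scale (b : R) (y : linf) : sup_norm (b *: y) <= `|b| * sup_norm y.
  apply: sup_norm_le => n.
  by rewrite normrM ler_wpM2l ?sup_norm_ub.
apply/eqP; rewrite eq_le le_scale /=.
have [->|a0] := eqVneq a 0.
  by rewrite normr0 mul0r (le_trans _ (sup_norm_ub _ 0%N)).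
rewrite -ler_pdivlMl ?normr_gt0// -normfV.
by rewrite -{1}[x](scalerK a0) le_scale.
Qed.

Fact sup_norm_eq0 (x : linf) : sup_norm x = 0 -> x = 0.
Proof.
move=> x0; apply/val_inj/funext => n /=.
by apply/normr0_eq0/le_anti; rewrite normr_ge0 -x0 sup_norm_ub.
Qed.

HB.instance Definition _ :=
  Lmodule_isNormed.Build R linf sup_normD sup_normZ sup_norm_eq0.

End Linf.

Section C0Linf.
Variable R : realType.
Local Notation Z := (density_ideal R).

Fact density_ideal0 : Z set0.
Proof.
rewrite /density_ideal /= (_ : density_ratio _ _ = fun=> 0); first exact: cvg_cst.
by apply/funext => n; rewrite /density_ratio set0I fset_set0 cardfs0 mul0r.
Qed.

Lemma finite_initial (S : set nat) n :
  finite_set (S `&` [set k | (1 <= k <= n)%N]).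
Proof.
apply: (sub_finite_set _ (finite_II n.+1)) => k [_ /= /andP[_]].
by rewrite ltnS.
Qed.

Lemma density_ratio_ge0 (S : set nat) n : 0 <= density_ratio R S n.
Proof. by rewrite divr_ge0. Qed.

Lemma density_ratioU (A B C : set nat) n : C `<=` A `|` B ->
  density_ratio R C n <= density_ratio R A n + density_ratio R B n.
Proof.
move=> CAB; rewrite -mulrDl ler_wpM2r ?invr_ge0// -natrD ler_nat.
set J := [set k | _].
suff: (fset_set (C `&` J) `<=`
    fset_set (A `&` J) `|` fset_set (B `&` J))%fset.
  by move=> /fsubset_leq_card/leq_trans; apply; rewrite leq_card_fsetU.
rewrite -fset_setU; [|exact: finite_initial..].
rewrite -fset_set_sub; [|exact: finite_initial|].
  by rewrite -setIUl; apply: setSI.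
by rewrite finite_setU; split; exact: finite_initial.
Qed.

Fact density_idealU (A B C : set nat) : C `<=` A `|` B -> Z A -> Z B -> Z C.
Proof.
move=> CAB ZA ZB.
apply: (@squeeze_cvgr _ _ _ _ (fun=> 0)
  (fun n => density_ratio R A n + density_ratio R B n)).
- by near=> n; rewrite density_ratio_ge0 density_ratioU.
- exact: cvg_cst.
- by rewrite -[0 in X in _ --> X](addr0 (0 : R)); exact: cvgD.
Unshelve. all: by end_near. Qed.

Definition c0_linf_pred : {pred linf R} := fun x => `[< c0 Z (x : nat -> R) >].

Record c0_linf : Type := C0Linf {
  c0_linf_val :> linf R ;
  c0_linf_valP : c0_linf_val \in c0_linf_pred }.

HB.instance Definition _ := [isSub for c0_linf_val].
HB.instance Definition _ := [Choice of c0_linf by <:].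

Fact c0_linf_submod_closed : submod_closed c0_linf_pred.
Proof.
split=> [|a x y /asboolP xZ /asboolP yZ]; apply/asboolP => U U0.
  apply: (density_idealU _ density_ideal0 density_ideal0) => n /=.
  by case; exact: nbhs_singleton.
have : (fun p : R * R => a * p.1 + p.2) @ nbhs ((0, 0) : R * R)
    --> (a * 0 + 0 : R).
  by apply: cvgD; [apply: cvgMl_tmp; exact: cvg_fst | exact: cvg_snd].
rewrite mulr0 addr0 => /(_ U U0)[[A B]] /= [A0 B0] ABU.
apply: density_idealU (xZ A A0) (yZ B B0) => n /= nU.
apply: contrapT => /not_orP[/contrapT xA /contrapT yB]; apply: nU.
exact: (ABU (x n, y n)).
Qed.

HB.instance Definition _ :=
  GRing.isSubmodClosed.Build R (linf R) c0_linf_pred c0_linf_submod_closed.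
HB.instance Definition _ := [SubChoice_isSubLmodule of c0_linf by <:].

Definition c0_linf_norm (x : c0_linf) : R := `|c0_linf_val x|.

Fact c0_linf_normD (x y : c0_linf) :
  c0_linf_norm (x + y) <= c0_linf_norm x + c0_linf_norm y.
Proof. exact: ler_normD. Qed.

Fact c0_linf_normZ (a : R) (x : c0_linf) :
  c0_linf_norm (a *: x) = `|a| * c0_linf_norm x.
Proof. exact: normrZ. Qed.

Fact c0_linf_norm_eq0 (x : c0_linf) : c0_linf_norm x = 0 -> x = 0.
Proof. by move=> /normr0_eq0 x0; exact: val_inj. Qed.

HB.instance Definition _ := Lmodule_isNormed.Build R c0_linf
  c0_linf_normD c0_linf_normZ c0_linf_norm_eq0.

End C0Linf.

(* Main.v *)
Require Import Defs.
From mathcomp Require Import all_boot all_order all_algebra.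
From mathcomp Require Import all_classical all_reals all_analysis.
From HB Require Import structures.
From mathcomp Require Import finmap ring.

(** Write X for the space of bounded statistically null sequences, and let
    I_k be the dyadic block of the integers n with 2^k <= n < 2^(k+1).

    The indicators e_k of the blocks span a copy of c_0 in X: the blocks are
    finite and disjoint, so a combination of the e_k with coefficients in
    [-1, 1] has norm at most 1.  The means mu_k over the blocks are functionals
    of norm at most 1 on X, biorthogonal to the e_k, and mu_k x --> 0 for every
    x in X, because a set of density 0 fills a vanishing proportion of I_k
    ([block_mean_cvg0]).  Hence c_0 is complemented in X.

    On l_infty no such system exists ([biorthogonal_not_weak_null]), and this
    is the reason why c_0 is not complemented in l_infty.  Suppose that u_k
    spans a copy of c_0 in l_infty and mu_k is biorthogonal to it.  The
    pointwise sum T a = sum_j a_j u_j is defined for every bounded a, not only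
    for a in c_0, and a |-> a_n - mu_n (T a) is, for each n, a bounded
    functional on l_infty vanishing on finitely supported sequences.  Countably
    many such functionals are simultaneously at most 1/2 on the indicator of
    some infinite set A ([small_on_infinite_set], a quantitative form of
    Whitley's argument for Phillips' theorem).  Then mu_n (T 1_A) >= 1/2 for
    every n in A, and so mu_n (T 1_A) does not tend to 0.

    An isomorphism between X and l_infty would carry the first system to one
    that the second result excludes. *)

Set Implicit Arguments.
Unset Strict Implicit.
Unset Printing Implicit Defensive.

Import Order.TTheory GRing.Theory Num.Theory.
Import numFieldNormedType.Exports.

Local Open Scope classical_set_scope.
Local Open Scope ring_scope.

(** * Functionals that vanish on finitely supported sequences *)

Lemma infinite_range_inj (h : nat -> nat) :
  injective h -> infinite_set (range h).
Proof.
move=> hinj /(finite_preimage (f := h)) hfin; apply: infinite_nat.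
by apply: sub_finite_set (hfin _); [move=> n _; exists n | exact: in2W].
Qed.

Lemma infinite_split (A : set nat) : infinite_set A ->
  exists B C : set nat,
    [/\ infinite_set B, infinite_set C, B `<=` A, C `<=` A & B `&` C = set0].
Proof.
move=> Ainf.
have [|f [fincr _ fA]] := infinite_increasing_seq_wf _ Ainf 0%N.
  move=> x; apply: sub_finite_set (finite_II x.+1) => y /=.
  by rewrite leEnat ltnS.
have finj : injective f by exact: inc_inj.
exists (range (f \o double)), (range (f \o (S \o double))); split.
- by apply/infinite_range_inj/inj_comp/double_inj.
- by apply/infinite_range_inj/inj_comp => // m n [/double_inj].
- by move=> _ [n _ <-]; exact: fA.
- by move=> _ [n _ <-]; exact: fA.
- apply/seteqP; split => // _ [[m _ <-] [n _ /finj /= e]].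
  by have := congr1 odd e; rewrite /= !odd_double.
Qed.

Section Whitley.
Variable R : realType.

Lemma indic_linf_subproof (A : set nat) : (\1_A : nat -> R) \in @linf_pred R.
Proof.
apply/linf_predP; exists 1 => n; rewrite indicE.
by case: (n \in A); rewrite ?normr1 ?normr0 ?ler01.
Qed.

Definition indic_linf (A : set nat) : linf R := Linf (indic_linf_subproof A).

Lemma indic_linf_in A n : A n -> indic_linf A n = 1.
Proof. by move=> An; rewrite /= indicE mem_set. Qed.

Lemma indic_linf_notin A n : ~ A n -> indic_linf A n = 0.
Proof. by move=> An; rewrite /= indicE memNset. Qed.

Lemma indic_linf_le1 A n : `|indic_linf A n| <= 1.
Proof.
have [/indic_linf_in->|/indic_linf_notin->] := pselect (A n).
  by rewrite normr1.
by rewrite normr0 ler01.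
Qed.

(** If every infinite P inside A contained a B with |L 1_B| > eps, then
    splitting A again and again into infinite halves would give m disjoint sets
    with this property; the sum of their indicators with suitable signs is in
    the unit ball, yet L is at least m * eps there.  The bound M limits m. *)
Lemma small_on_infinite_subset (L : {scalar linf R}) (M eps : R) (A : set nat) :
  (forall a : linf R, (forall i, `|a i| <= 1) -> `|L a| <= M) -> 0 < eps ->
  infinite_set A ->
  exists P, [/\ infinite_set P, P `<=` A &
    forall B, B `<=` P -> `|L (indic_linf B)| <= eps].
Proof.
move=> LM eps0 Ainf; apply: contrapT => noP.
have large P : infinite_set P -> P `<=` A ->
    exists2 B, B `<=` P & eps < `|L (indic_linf B)|.
  move=> Pinf PA; apply: contrapT => nB; apply: noP; exists P; split => // B BP.
  by rewrite leNgt; apply/negP => lt; apply: nB; exists B.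
have acc m : forall P, infinite_set P -> P `<=` A -> exists a : linf R,
    [/\ forall i, `|a i| <= 1, forall i, ~ P i -> a i = 0 & m%:R * eps <= L a].
  elim: m => [|m IHm] P Pinf PA.
    exists 0; split => [i|//|]; first by rewrite normr0 ler01.
    by rewrite mul0r raddf0.
  have [P1 [P2 [P1inf P2inf P1P P2P P12]]] := infinite_split Pinf.
  have [a [a1 aP1 La]] := IHm P1 P1inf (subset_trans P1P PA).
  have [B BP2 LB] := large P2 P2inf (subset_trans P2P PA).
  (* with this sign the new block adds |L 1_B| to L a *)
  pose s := Num.sg (L (indic_linf B)).
  have disj i : P1 i -> ~ P2 i.
    by move=> Pi1 Pi2; have : (P1 `&` P2) i by []; rewrite P12.
  have LB0 : L (indic_linf B) != 0 by rewrite -normr_gt0 (lt_trans eps0).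
  exists (a + s *: indic_linf B); split => [i|i nPi|].
  - change (`|a i + s * indic_linf B i| <= 1).
    have [Bi|nBi] := pselect (B i).
      rewrite aP1 ?add0r => [|/disj]; last by apply; exact: BP2.
      by rewrite normrM normr_sg LB0 mul1r indic_linf_le1.
    by rewrite indic_linf_notin// mulr0 addr0.
  - change (a i + s * indic_linf B i = 0).
    rewrite aP1 ?indic_linf_notin ?mulr0 ?addr0 => [//|/BP2/P2P|/P1P];
      exact: nPi.
  - by rewrite raddfD/= scalarZ -normrEsg mulrSr mulrDl mul1r lerD// ltW.
have [a [a1 _ La]] := acc (Num.bound (M / eps)) A Ainf (fun _ => id).
have M0 : 0 <= M by exact: le_trans (normr_ge0 _) (LM a a1).
have := archi_boundP (divr_ge0 M0 (ltW eps0)).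
rewrite ltr_pdivrMr// ltNge => /negP; apply.
exact: le_trans La (le_trans (ler_norm _) (LM a a1)).
Qed.

(** A diagonal argument.  Iterating [small_on_infinite_subset] gives decreasing
    infinite sets P_(n+1) such that L_n is small on the indicators of all
    subsets of P_(n+1).  A set A whose n-th point lies in P_(n+1) is contained
    in each P_(n+1) up to finitely many points, which L_n does not see. *)
Lemma small_on_infinite_set (L : nat -> {scalar linf R}) (M : nat -> R)
    (eps : R) :
  (forall n (a : linf R), (forall i, `|a i| <= 1) -> `|L n a| <= M n) ->
  (forall n (a : linf R) N, (forall i, (N <= i)%N -> a i = 0) -> L n a = 0) ->
  0 < eps ->
  exists2 A, infinite_set A & forall n, `|L n (indic_linf A)| <= eps.
Proof.
move=> LM Lfin eps0.
pose inf := {A : set nat | infinite_set A}.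
have step (s : nat * inf) : {t : nat * inf | [/\ t.1 = s.1.+1,
    sval t.2 `<=` sval s.2 & forall B, B `<=` sval t.2 ->
    `|L s.1 (indic_linf B)| <= eps]}.
  have [P [Pinf PA PL]] :=
    cid (small_on_infinite_subset (LM s.1) eps0 (svalP s.2)).
  by exists (s.1.+1, exist _ P Pinf).
have [F [F0 FS]] := dependent_choice step (0%N, exist _ setT infinite_nat).
have F1 n : (F n).1 = n.
  by elim: n => [|n IHn]; [rewrite F0 | have [-> _ _] := FS n; rewrite IHn].
pose P n := sval (F n).2.
have Pdec m n : (m <= n)%N -> P n `<=` P m.
  elim: n => [|n IHn]; first by rewrite leqn0 => /eqP ->.
  rewrite leq_eqVlt => /predU1P[->//|/IHn]; apply: subset_trans.
  by have [] := FS n.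
have pick n : {k | (n <= k)%N /\ P n.+1 k}.
  apply: cid; apply: contrapT => nk; apply: (svalP (F n.+1).2).
  apply: sub_finite_set (finite_II n) => k Pk /=.
  by rewrite ltnNge; apply/negP => nk'; apply: nk; exists k.
pose u n := sval (pick n).
have un n : (n <= u n)%N by have [] := svalP (pick n).
have uP n : P n.+1 (u n) by have [] := svalP (pick n).
(* u n >= n makes the range of u unbounded *)
exists (range u) => [fin|n].
  have [s us] := iffLR (finite_seqP _) fin.
  have : range u (u (\max_(k <- s) k).+1) by exists (\max_(k <- s) k).+1.
  rewrite us /= => um; have := @leq_bigmax_seq _ s xpredT id _ um isT.
  by rewrite leqNgt => /negP; apply; apply: leq_trans (un _).
have LB : `|L n (indic_linf (range u `&` P n.+1))| <= eps.
  by have [_ _ ] := FS n; rewrite F1; apply; exact: subIsetr.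
suff : L n (indic_linf (range u) - indic_linf (range u `&` P n.+1)) = 0.
  by rewrite raddfB => /subr0_eq ->.
(* the points of A outside P_(n+1) are among u 0, ..., u (n-1) *)
apply: (Lfin _ _ (\max_(j < n) (u j).+1)%N) => i Ni.
change (indic_linf (range u) i - indic_linf (range u `&` P n.+1) i = 0).
have [[j _ uj]|nui] := pselect (range u i); last first.
  by rewrite !indic_linf_notin ?subrr// => -[].
have nj : (n <= j)%N.
  rewrite leqNgt; apply/negP => jn; move: Ni.
  by rewrite leqNgt -uj => /negP; apply; exact: (leq_bigmax (Ordinal jn)).
rewrite !indic_linf_in ?subrr//; last by exists j.
by split; [exists j | rewrite -uj; apply: (Pdec _ j.+1) => //; exact: uP].
Qed.
End Whitley.

(** * Extending an embedding of c_0 to bounded coefficients *)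

Lemma linf_sumE (R : realType) (v : nat -> linf R) (m n : nat) :
  (\sum_(0 <= j < m) v j : linf R) n = \sum_(0 <= j < m) v j n.
Proof. exact: (big_morph (fun x : linf R => x n) (id1 := 0) (op1 := +%R)). Qed.

Section UnconditionalSum.
Variables (R : realType) (u : nat -> linf R) (C : R).

(* A uniform bound on the coordinatewise absolute sums says that u is weakly
   unconditionally Cauchy, that is, that the unit vectors of c_0 can be sent
   to u by a bounded operator. *)
Hypothesis uC : forall (m n : nat), \sum_(0 <= j < m) `|u j n| <= C.

Lemma wuc_partial_sum_le (a : linf R) (n m : nat) :
  [normed series (fun j => a j * u j n)] m <= `|a| * C.
Proof.
rewrite /= seriesEnat/=.
under eq_bigr do rewrite normrM.
apply: (@le_trans _ _ (\sum_(0 <= j < m) `|a| * `|u j n|)).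
  by apply: ler_sum => j _; rewrite ler_wpM2r// sup_norm_ub.
by rewrite -mulr_sumr ler_wpM2l.
Qed.

Lemma wuc_normed_cvg (a : linf R) n :
  cvgn [normed series (fun j => a j * u j n)].
Proof.
apply: nondecreasing_is_cvgn.
  apply/nondecreasing_seqP => m.
  by rewrite /= seriesEnat/= big_nat_recr//= lerDl.
by exists (`|a| * C) => _ [m _ <-]; exact: wuc_partial_sum_le.
Qed.

Lemma wuc_sum_bound (a : linf R) (n : nat) :
  `|limn (series (fun j => a j * u j n))| <= `|a| * C.
Proof.
have cvn := @wuc_normed_cvg a n.
apply: le_trans (lim_series_norm cvn) _; apply: limr_le => //.
by near=> m; exact: wuc_partial_sum_le.
Unshelve. all: by end_near. Qed.

Lemma wuc_sum_subproof (a : linf R) :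
  (fun n => limn (series (fun j => a j * u j n))) \in @linf_pred R.
Proof. by apply/linf_predP; exists (`|a| * C) => n; exact: wuc_sum_bound. Qed.

(** The sum of the a_j u_j is taken coordinate by coordinate: in norm it need
    not converge when a is not in c_0. *)
Definition wuc_sum (a : linf R) : linf R := Linf (wuc_sum_subproof a).

Lemma wuc_sum_norm a : `|wuc_sum a| <= `|a| * C.
Proof. by apply: sup_norm_le => n; exact: wuc_sum_bound. Qed.

Lemma wuc_sum_linear : linear wuc_sum.
Proof.
move=> k a b; apply/val_inj/funext => n /=.
have cva := normed_cvg (@wuc_normed_cvg a n).
have cvb := normed_cvg (@wuc_normed_cvg b n).
rewrite -[RHS]/(k *: limn _ + limn _) -lim_seriesZ// -lim_seriesD//;
  last exact: is_cvg_seriesZ.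
congr (limn (series _)); apply/funext => j.
by rewrite -[LHS]/((k * a j + b j) * u j n) mulrDl -mulrA.
Qed.

Lemma wuc_sum_finite (a : linf R) N : (forall i, (N <= i)%N -> a i = 0) ->
  wuc_sum a = \sum_(0 <= j < N) a j *: u j.
Proof.
move=> aN; apply/val_inj/funext => n.
rewrite [RHS](linf_sumE (fun j => a j *: u j)).
apply: lim_near_cst => //; near=> m; rewrite seriesEnat/=.
rewrite (@big_cat_nat _ _ _ N)//=; last by near: m; exact: nbhs_infty_ge.
rewrite [X in _ + X = _]big_nat [X in _ + X = _]big1 ?addr0// => j /andP[Nj _].
by rewrite aN// mul0r.
Unshelve. all: by end_near. Qed.

End UnconditionalSum.

(** At a fixed coordinate n, the signs of the u_j n turn the sum of absolute
    values into the value at n of a combination of the u_j. *)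
Lemma sum_abs_le_of_signs (R : realType) (u : nat -> linf R) (C : R) :
  (forall m (s : nat -> R), (forall j, `|s j| <= 1) ->
     `|\sum_(0 <= j < m) s j *: u j| <= C) ->
  forall m n : nat, \sum_(0 <= j < m) `|u j n| <= C.
Proof.
move=> uC m n.
apply: le_trans (uC m (fun j => Num.sg (u j n)) _); last first.
  by move=> j; rewrite normr_sg; case: (_ != 0); rewrite ?ler01.
under eq_bigr do rewrite normrEsg.
rewrite -[leLHS](linf_sumE (fun j => Num.sg (u j n) *: u j)).
exact: le_trans (ler_norm _) (sup_norm_ub _ n).
Qed.

(** Were mu_n y --> 0 for all y, the operator y |-> (mu_n y)_n after [wuc_sum u]
    would be a projection of l_infty onto c_0.  The functionals L_n below are
    the coordinates of the complementary projection; they vanish on finitely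
    supported sequences by biorthogonality. *)
Lemma biorthogonal_not_weak_null (R : realType) (u : nat -> linf R) (C : R)
    (mu : nat -> {scalar linf R}) (K : nat -> R) :
  (forall m n : nat, \sum_(0 <= j < m) `|u j n| <= C) ->
  (forall n y, `|mu n y| <= K n * `|y|) ->
  (forall n j, mu n (u j) = (n == j)%:R) ->
  exists y, ~ (mu n y @[n --> \oo] --> (0 : R)).
Proof.
move=> uC muK muu.
have C0 : 0 <= C by have := uC 0%N 0%N; rewrite big_geq.
pose L0 n (a : linf R) : R := a n - mu n (wuc_sum uC a).
have L0lin n : scalar (L0 n).
  move=> k a b; rewrite /L0 wuc_sum_linear raddfD/= scalarZ.
  by rewrite -[LHS]/(k * a n + b n - _); ring.
pose L n : {scalar linf R} :=
  HB.pack (L0 n) (GRing.isLinear.Build R (linf R) R *%R (L0 n) (L0lin n)).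
have LM n (a : linf R) : (forall i, `|a i| <= 1) -> `|L n a| <= 1 + `|K n| * C.
  move=> a1; have na1 : `|a| <= 1 by exact: sup_norm_le.
  apply: le_trans (ler_normB _ _) _; apply: lerD => //.
  apply: le_trans (muK _ _) _.
  apply: (@le_trans _ _ (`|K n| * `|wuc_sum uC a|)).
    by rewrite ler_wpM2r ?ler_norm.
  by rewrite ler_wpM2l// (le_trans (wuc_sum_norm uC a))// ler_piMl.
have Lfin n (a : linf R) N : (forall i, (N <= i)%N -> a i = 0) -> L n a = 0.
  move=> aN; rewrite /L/= /L0 (wuc_sum_finite uC aN) raddf_sum/=.
  under eq_bigr do rewrite scalarZ muu.
  have [nN|Nn] := ltnP n N.
    rewrite big_mkord (bigD1 (Ordinal nN))//= eqxx mulr1 big1 ?addr0 ?subrr//.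
    move=> j jn; have -> : (n == j) = false; last by rewrite mulr0.
    by apply: contra_neqF jn => /eqP nj; exact: val_inj.
  rewrite aN// big_nat big1 ?subr0// => j /andP[_ jN].
  by rewrite gtn_eqF ?mulr0// (leq_trans jN).
have half0 : 0 < 2^-1 :> R by rewrite invr_gt0.
have [A Ainf AL] := small_on_infinite_set LM Lfin half0.
exists (wuc_sum uC (indic_linf R A)) => mu0.
have [N _ muN] := cvgr0_norm_lt _ mu0 _ half0.
have [n [An Nn]] : exists n, A n /\ (N <= n)%N.
  apply: contrapT => nA; apply: Ainf.
  apply: sub_finite_set (finite_II N) => n An /=.
  by rewrite ltnNge; apply/negP => Nn; apply: nA; exists n.
have := AL n; rewrite /L/= /L0 indic_linf_in// => ALn.
have := le_lt_trans (ler_normD _ _) (ler_ltD ALn (muN n Nn)).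
by rewrite subrK normr1 -[X in _ < X + _]mul1r -[X in _ < _ + X]mul1r
  -splitr ltxx.
Qed.

(** * Dyadic means of statistically null sequences *)

Section Blocks.
Variable R : realType.

Lemma bounded_density_ideal (S : set nat) N : S `<=` `I_N -> density_ideal R S.
Proof.
move=> SN; apply: (@squeeze_cvgr _ _ _ _ (fun=> 0) (fun n => N%:R / n%:R)).
- near=> n; rewrite density_ratio_ge0 ler_wpM2r ?invr_ge0// ler_nat.
  apply: geq_card_fset_set; apply: subset_card_le.
  by move=> k [/SN].
- exact: cvg_cst.
- rewrite -[0 in X in _ --> X](mulr0 (N%:R : R)); apply: cvgMl_tmp.
  apply/gtr0_cvgV0; last exact: cvgr_idn.
  by near=> n; rewrite ltr0n; near: n; exact: nbhs_infty_gt.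
Unshelve. all: by end_near. Qed.

Definition dyadic (k : nat) : set nat := [set n | (2 ^ k <= n < 2 ^ k.+1)%N].

Definition block_mean (x : nat -> R) (k : nat) : R :=
  (\sum_(2 ^ k <= n < 2 ^ k.+1) x n) / (2 ^ k)%:R.

Let pow2_gt0 k : 0 < (2 ^ k)%:R :> R.
Proof. by rewrite ltr0n expn_gt0. Qed.

Let dyadic_size k : (2 ^ k.+1 - 2 ^ k = 2 ^ k)%N.
Proof. by rewrite expnS mul2n -addnn addnK. Qed.

(** I_k lies in [1, 2^(k+1)], an interval only twice as long as I_k, so small
    density of D in that interval forces small density in I_k. *)
Lemma sum_mem_dyadic (D : set nat) k :
  \sum_(2 ^ k <= n < 2 ^ k.+1) (n \in D)%:R <=
  2 * (2 ^ k)%:R * density_ratio R D (2 ^ k.+1).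
Proof.
rewrite -natrM -expnS /density_ratio mulrCA divff ?mulr1 ?gt_eqF//.
rewrite -natr_sum ler_nat.
have -> : (\sum_(2 ^ k <= n < 2 ^ k.+1) (n \in D) =
    size [seq n <- index_iota (2 ^ k) (2 ^ k.+1) | n \in D])%N.
  rewrite -sum1_size big_filter [RHS]big_mkcond.
  by apply: eq_bigr => n _; case: (n \in D).
apply: uniq_leq_size; first by rewrite filter_uniq// iota_uniq.
move=> n; rewrite mem_filter mem_index_iota => /and3P[/set_mem Dn kn nk].
rewrite in_fset_set; last exact: finite_initial.
apply/mem_set; split => //=.
by rewrite (leq_trans _ kn) ?expn_gt0//= ltnW.
Qed.

Lemma block_mean_abs_le (x : nat -> R) M k : (forall n, `|x n| <= M) ->
  `|block_mean x k| <= M.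
Proof.
move=> xM; rewrite normrM normfV (gtr0_norm (pow2_gt0 k)) ler_pdivrMr//.
apply: le_trans (ler_norm_sum _ _ _) _.
apply: (@le_trans _ _ (\sum_(2 ^ k <= n < 2 ^ k.+1) M)); first exact: ler_sum.
by rewrite sumr_const_nat dyadic_size mulr_natr.
Qed.

Lemma block_mean_linear k : scalar (fun x : c0_linf R => block_mean x k).
Proof.
move=> a x y; rewrite /block_mean mulrA -mulrDl mulr_sumr -big_split/=.
by [].
Qed.

(** The entries of x larger than e/2 sit on a set D of density 0 and are at most
    the norm of x, so their contribution to the mean over I_k is at most twice
    that norm times the density ratio of D at 2^(k+1); the others contribute at
    most e/2. *)
Lemma block_mean_cvg0 (x : c0_linf R) : block_mean x @ \oo --> (0 : R).
Proof.
have /asboolP xZ := c0_linf_valP x.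
apply/cvgr0Pnorm_le => e e0.
pose D := [set n | ~ ball (0 : R) (e / 2) (x n)].
have ZD : density_ideal R D by apply: xZ; apply: nbhsx_ballx; rewrite divr_gt0.
(* the 1 only keeps the denominator below away from 0 when x = 0 *)
have M0 : 0 < 4 * (`|x| + 1) by rewrite mulr_gt0// ltr_wpDl.
have pow2_oo : (2 ^ k.+1)%N @[k --> \oo] --> \oo.
  apply/cvgnyPge => N; near=> k.
  apply: leq_trans (ltnW (ltn_expl k.+1 (isT : 1 < 2)%N)).
  by apply: leqW; near: k; exact: nbhs_infty_ge.
have ratio0 : density_ratio R D (2 ^ k.+1) @[k --> \oo] --> (0 : R).
  by apply: (cvg_comp _ _ pow2_oo); exact: ZD.
near=> k.
have small : `|density_ratio R D (2 ^ k.+1)| <= e / (4 * (`|x| + 1)).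
  by near: k; apply: cvgr0_norm_le ratio0 _ _; rewrite divr_gt0.
rewrite ger0_norm ?density_ratio_ge0// in small.
rewrite normrM normfV (gtr0_norm (pow2_gt0 k)) ler_pdivrMr//.
apply: le_trans (ler_norm_sum _ _ _) _.
apply: (@le_trans _ _
  (\sum_(2 ^ k <= n < 2 ^ k.+1) (e / 2 + `|x| * (n \in D)%:R))).
  apply: ler_sum => n _; have [Dn|nDn] := pselect (D n).
    rewrite mem_set// mulr1 ler_wpDl ?divr_ge0 ?(ltW e0)//.
    exact: sup_norm_ub.
  rewrite memNset// mulr0 addr0.
  by have := contrapT nDn; rewrite /ball/= sub0r normrN => /ltW.
rewrite big_split/= sumr_const_nat dyadic_size -mulr_sumr.
apply: (@le_trans _ _ ((2 ^ k)%:R * (e / 2) +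
   (`|x| + 1) * (2 * (2 ^ k)%:R * (e / (4 * (`|x| + 1)))))).
  apply: lerD; first by rewrite mulr_natl.
  apply: ler_pM; rewrite ?sumr_ge0 ?lerDl//.
  by apply: le_trans (sum_mem_dyadic D k) _; rewrite ler_wpM2l ?mulr_ge0.
rewrite le_eqVlt; apply/orP; left; apply/eqP; field.
by rewrite gt_eqF// ltr_wpDl.
Unshelve. all: by end_near. Qed.
End Blocks.

Section BlockIndicators.
Variable R : realType.

Lemma dyadic_indic_subproof k : indic_linf R (dyadic k) \in @c0_linf_pred R.
Proof.
apply/asboolP => U U0; apply: (@bounded_density_ideal _ _ (2 ^ k.+1)) => n /=.
apply: contra_notT => nk; rewrite indicE memNset; first exact: nbhs_singleton.
by rewrite /dyadic/= => /andP[_]; exact/negP.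
Qed.

Definition dyadic_indic k : c0_linf R := C0Linf (dyadic_indic_subproof k).

Lemma dyadic_disjoint i j n : dyadic i n -> dyadic j n -> i = j.
Proof.
move=> /andP[i1 i2] /andP[j1 j2]; apply/eqP; rewrite eqn_leq.
by rewrite -ltnS -(ltn_exp2l _ _ (isT : 1 < 2)%N) (leq_ltn_trans i1)//
  -[(j <= i)%N]ltnS -(ltn_exp2l _ _ (isT : 1 < 2)%N) (leq_ltn_trans j1).
Qed.

Lemma block_mean_dyadic_indic n j :
  block_mean (dyadic_indic j) n = (n == j)%:R.
Proof.
have pow2 : (2 ^ n)%:R != 0 :> R by rewrite pnatr_eq0 expn_eq0.
rewrite /block_mean big_nat.
have [<-|nj] := eqVneq n j.
  rewrite (eq_bigr (fun=> 1)) => [|i ni]; last exact: indic_linf_in.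
  by rewrite -big_nat sumr_const_nat expnS mul2n -addnn addnK divff.
rewrite big1 ?mul0r// => i ni; apply: indic_linf_notin => ji.
by move/eqP: nj; apply; exact: dyadic_disjoint ni ji.
Qed.

Lemma dyadic_indic_norm_le (s : nat -> R) m : (forall j, `|s j| <= 1) ->
  `|\sum_(0 <= j < m) s j *: dyadic_indic j| <= 1.
Proof.
move=> s1; apply: sup_norm_le => n.
rewrite (big_morph (fun x : c0_linf R => x n) (id1 := 0) (op1 := +%R))//.
have [[j jn]|nj] := pselect (exists j, dyadic j n); last first.
  rewrite big1 ?normr0 ?ler01// => j _.
  rewrite -[LHS]/(s j * indic_linf R (dyadic j) n).
  by rewrite indic_linf_notin ?mulr0// => jn; apply: nj; exists j.
have zero i : i != j -> (s i *: dyadic_indic i) n = 0.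
  move=> ij; rewrite -[LHS]/(s i * indic_linf R (dyadic i) n).
  rewrite indic_linf_notin ?mulr0// => /dyadic_disjoint/(_ jn) eij.
  by rewrite eij eqxx in ij.
have [jm|mj] := ltnP j m.
  rewrite big_mkord (bigD1 (Ordinal jm))//= big1 ?addr0 => [|i]; last first.
    by move=> ij; apply: zero; apply: contra_neq ij => ij; exact: val_inj.
  rewrite -[X in `|X|]/(s j * indic_linf R (dyadic j) n) normrM.
  by rewrite mulr_ile1// indic_linf_le1.
rewrite big_nat big1 ?normr0 ?ler01// => i /andP[_ im].
by apply: zero; rewrite ltn_eqF// (leq_trans im).
Qed.
End BlockIndicators.

(** * The isomorphism *)

Lemma continuous_linear_le (R : realType) (V W : normedModType R)
  (f : {linear V -> W}) : continuous f ->
  exists2 C, 0 <= C & forall x, `|f x| <= C * `|x|.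
Proof.
move=> fc; have /linear_boundedP := continuous_linear_bounded 0 (fc 0).
move=> [C [Creal fC]]; exists (`|C| + 1) => [|x]; first by rewrite addr_ge0.
by apply: fC; rewrite (le_lt_trans (ler_norm _))// ltrDl.
Qed.

Theorem corollary1p4 (R : realType) : ~ isomorphic (c0_linf R) (linf R).
Proof.
move=> [f [g [fK gK fc gc]]].
have glin : linear g := can2_linear fK gK.
pose gL : {linear linf R -> c0_linf R} :=
  HB.pack g (GRing.isLinear.Build R (linf R) (c0_linf R) *:%R g glin).
have [C C0 fC] := continuous_linear_le fc.
have [K K0 gK'] := continuous_linear_le (gc : continuous gL).
pose mu0 n (y : linf R) := block_mean (g y) n.
have mu0lin n : scalar (mu0 n).
  by move=> k a b; rewrite /mu0 glin block_mean_linear.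
pose mu n : {scalar linf R} :=
  HB.pack (mu0 n) (GRing.isLinear.Build R (linf R) R *%R (mu0 n) (mu0lin n)).
(* transporting the blocks by f and their means by g gives a biorthogonal
   system in l_infty with means tending to 0 everywhere *)
have [||n j|y] :=
  @biorthogonal_not_weak_null R (f \o @dyadic_indic R) C mu (fun=> K).
- apply: sum_abs_le_of_signs => m s s1.
  have -> : \sum_(0 <= j < m) s j *: (f \o @dyadic_indic R) j =
      f (\sum_(0 <= j < m) s j *: dyadic_indic R j).
    by rewrite raddf_sum; apply: eq_bigr => j _; exact/esym/linearZ_LR.
  apply: le_trans (fC _) _.
  by rewrite ler_piMr//; exact: dyadic_indic_norm_le.
- move=> n y; apply: le_trans (gK' y); apply: block_mean_abs_le => i.
  exact: sup_norm_ub.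
- by rewrite /mu/= /mu0/= fK block_mean_dyadic_indic.
- by apply; exact: block_mean_cvg0.
Qed.
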